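(* For even $n$, let $A(n)=(A_{yes}(n),A_{no}(n))$ be the promise problem over the alphabet $\{0,1,\#\}$ with $$A_{yes}(n)=\{x\#y\#\#x\#y : x,y\in\{0,1\}^n,\ H(x,y)\in\{0,1,n-1,n\}\},$$ $$A_{no}(n)=\{x\#y\#\#x\#y : x,y\in\{0,1\}^n,\ H(x,y)=\tfrac{n}{2}\},$$ where $H(x,y)$ is the Hamming distance. Then $A(n)$ can be solved exactly by a 1QCFA with $\mathbf{O}(n^2)$ quantum basis states and $\mathbf{O}(n^3)$ classical states, whereas every one-way deterministic finite automaton (1DFA) solving $A(n)$ has $2^{\mathbf{\Omega}(n)}$ states.
   Context: A one-way finite automaton with quantum and classical states (1QCFA) is a tuple $(Q,S,\Sigma,\Theta,\Delta,\delta,|q_0\rangle,s_0,S_{acc},S_{rej})$ where $Q$ is a finite set of orthonormal quantum basis states spanning a Hilbert space $\mathcal{H}(Q)$; $S$ is a finite set of classical states; $\Sigma$ is the input alphabet, and $\Sigma'=\Sigma\cup\{\cent,\$\}$ with end-markers $\cent,\$$; $|q_0\rangle\in Q$ and $s_0\in S$ are the initial quantum and classical states; $S_{acc},S_{rej}\subset S$ are disjoint sets of accepting and rejecting classical states; $\Theta$ assigns to each non-halting classical state $s$ and symbol $\gamma\in\Sigma'$ a unitary operator on $\mathcal{H}(Q)$; $\Delta$ assigns to each $(s,\gamma)$ a projective measurement on $\mathcal{H}(Q)$ (possibly trivial, with a fixed outcome) with outcome set $\mathcal{C}$; and $\delta:S\times\Sigma'\times\mathcal{C}\to S$ is the classical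 transition function. On input $w=\sigma_1\cdots\sigma_l$, the tape contains $\cent w\$$, the automaton starts in $s_0$ and $|q_0\rangle$, and reads the symbols left to right; on reading $\sigma$ in classical state $s$ with quantum state $|\phi\rangle$, it applies $\Theta(s,\sigma)$, then measures with $\Delta(s,\sigma)$, obtaining outcome $c_k$ with probability $\|P(c_k)\Theta(s,\sigma)|\phi\rangle\|^2$ and collapsing the quantum state accordingly, then moves to classical state $\delta(s,\sigma,c_k)$. The input is accepted (rejected) iff the classical state after reading $\$$ is in $S_{acc}$ ($S_{rej}$). An automaton solves a promise problem $(A_{yes},A_{no})$ exactly if it accepts every $w\in A_{yes}$ with probability $1$ and rejects every $w\in A_{no}$ with probability $1$ (no requirement on other inputs); for a 1DFA this means it accepts all of $A_{yes}$ and rejects all of $A_{no}$. *)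

(* Defs.v *)
From mathcomp Require Import all_boot all_order all_algebra.
From mathcomp Require Import complex reals.
Set Implicit Arguments.
Unset Strict Implicit.
Unset Printing Implicit Defensive.
Import Order.TTheory GRing.Theory Num.Theory.
Local Open Scope ring_scope.
Local Open Scope complex_scope.
Local Open Scope sesquilinear_scope.

Inductive tape_sym (Sigma : finType) :=
  | lend_marker
  | tape_letter of Sigma
  | rend_marker.

Arguments lend_marker {Sigma}.
Arguments tape_letter {Sigma}.
Arguments rend_marker {Sigma}.

Definition tape (Sigma : finType) (w : seq Sigma) : seq (tape_sym Sigma) :=
  lend_marker :: rcons [seq tape_letter a | a <- w] rend_marker.

(* A projector may be 0, so a measurement using only some of the outcomes in C
   (in particular the trivial one, with a fixed outcome) is included. *)
Definition projective_measurement (R : realType) (C : finType) (d : nat)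
    (P : C -> 'M[R[i]]_d) : Prop :=
  [/\ forall c, (P c) ^t* = P c,
      forall c, P c *m P c = P c,
      forall c c', c != c' -> P c *m P c' = 0
    & \sum_c P c = 1%:M].

(* H(Q) is the space of column vectors of dimension #|Q|; the basis state q is
   the vector with a single 1 at position enum_rank q.  No unitarity is imposed
   on qcfa_op at halting states, where it is never used (see qcfa_prob). *)
Record qcfa (R : realType) (Sigma : finType) := QCFA {
  qcfa_qstate : finType;
  qcfa_cstate : finType;
  qcfa_outcome : finType;
  qcfa_op : qcfa_cstate -> tape_sym Sigma -> 'M[R[i]]_#|qcfa_qstate|;
  qcfa_meas : qcfa_cstate -> tape_sym Sigma -> qcfa_outcome ->
              'M[R[i]]_#|qcfa_qstate|;
  qcfa_trans : qcfa_cstate -> tape_sym Sigma -> qcfa_outcome -> qcfa_cstate;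
  qcfa_q0 : qcfa_qstate;
  qcfa_s0 : qcfa_cstate;
  qcfa_acc : {set qcfa_cstate};
  qcfa_rej : {set qcfa_cstate};
  qcfa_acc_rej_disjoint : [disjoint qcfa_acc & qcfa_rej];
  qcfa_op_unitary : forall s g,
    s \notin qcfa_acc :|: qcfa_rej -> qcfa_op s g \is unitarymx;
  qcfa_meas_proj : forall s g, projective_measurement (qcfa_meas s g)
}.

Definition qnorm (R : realType) (d : nat) (v : 'cV[R[i]]_d) : R :=
  Num.sqrt (\sum_i ComplexField.Normc.normc (v i 0) ^+ 2).

(* Probability that, started in classical state s and quantum state phi, the
   automaton is in a classical state of F after reading u.  A halting state has
   no unitary operator assigned, and the automaton stays in it.  An outcome of
   probability 0 contributes 0, so its (undefined) collapsed state is
   irrelevant. *)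
Fixpoint qcfa_prob (R : realType) (Sigma : finType) (M : qcfa R Sigma)
    (F : {set qcfa_cstate M}) (u : seq (tape_sym Sigma)) (s : qcfa_cstate M)
    (phi : 'cV[R[i]]_#|qcfa_qstate M|) {struct u} : R :=
  match u with
  | [::] => (s \in F)%:R
  | g :: u' =>
      if s \in qcfa_acc M :|: qcfa_rej M then qcfa_prob F u' s phi else
      \sum_(c : qcfa_outcome M)
        let psi := qcfa_meas s g c *m (qcfa_op s g *m phi) in
        qnorm psi ^+ 2 *
        qcfa_prob F u' (qcfa_trans s g c) (((qnorm psi)^-1)%:C *: psi)
  end.

Definition qcfa_run_prob (R : realType) (Sigma : finType) (M : qcfa R Sigma)
    (F : {set qcfa_cstate M}) (w : seq Sigma) : R :=
  qcfa_prob F (tape w) (qcfa_s0 M) (delta_mx (enum_rank (qcfa_q0 M)) 0).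

Definition qcfa_accept_prob (R : realType) (Sigma : finType)
    (M : qcfa R Sigma) (w : seq Sigma) : R := qcfa_run_prob (qcfa_acc M) w.

Definition qcfa_reject_prob (R : realType) (Sigma : finType)
    (M : qcfa R Sigma) (w : seq Sigma) : R := qcfa_run_prob (qcfa_rej M) w.

Record dfa (Sigma : finType) := DFA {
  dfa_state : finType;
  dfa_trans : dfa_state -> Sigma -> dfa_state;
  dfa_s0 : dfa_state;
  dfa_acc : {set dfa_state}
}.

Definition dfa_accepts (Sigma : finType) (D : dfa Sigma) (w : seq Sigma) : bool :=
  foldl (@dfa_trans Sigma D) (dfa_s0 D) w \in dfa_acc D.

Record promise_problem (Sigma : finType) := PromiseProblem {
  yes_instance : seq Sigma -> Prop;
  no_instance : seq Sigma -> Prop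
}.

Definition qcfa_solves_exactly (R : realType) (Sigma : finType)
    (M : qcfa R Sigma) (A : promise_problem Sigma) : Prop :=
  (forall w, yes_instance A w -> qcfa_accept_prob M w = 1) /\
  (forall w, no_instance A w -> qcfa_reject_prob M w = 1).

Definition dfa_solves (Sigma : finType) (D : dfa Sigma)
    (A : promise_problem Sigma) : Prop :=
  (forall w, yes_instance A w -> dfa_accepts D w) /\
  (forall w, no_instance A w -> ~~ dfa_accepts D w).

(* The alphabet {0, 1, #}: Some b is the bit b, and None is #. *)
Definition letter : finType := option bool.
Definition sharp : letter := None.
Definition bits (n : nat) (x : n.-tuple bool) : seq letter :=
  [seq Some b | b <- x].

Definition hamming (n : nat) (x y : n.-tuple bool) : nat :=
  #|[set i : 'I_n | tnth x i != tnth y i]|.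

Definition xyxy (n : nat) (x y : n.-tuple bool) : seq letter :=
  bits x ++ [:: sharp] ++ bits y ++ [:: sharp; sharp] ++
  bits x ++ [:: sharp] ++ bits y.

Definition problem_A (n : nat) : promise_problem letter :=
  {| yes_instance := fun w => exists x y : n.-tuple bool,
       w = xyxy x y /\ hamming x y \in [:: 0; 1; n - 1; n]%N;
     no_instance := fun w => exists x y : n.-tuple bool,
       w = xyxy x y /\ hamming x y = n./2 |}.

(* Main.v *)
(* Lower bound.  The states of a 1DFA after x#, x#y## and x#y##x# label the pairs
   (x, y) so that equally labelled pairs form a rectangle.  Labelling the pairs
   (0u, bu) with b = n/2 mod 2 and using that pairs at distance n/2 are rejected,
   one gets a family of vectors u of one weight that avoids the distance
   2 floor(n/4), that is, one size of pairwise intersections, and which has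
   at least 2^(n-1) / (n K^3) members if there are K states.  Such a family is
   exponentially small, by an argument in the style of Frankl and Roedl: for
   families S, T avoiding an interval of intersection sizes, splitting off a
   coordinate either gives new families with a larger product of densities that
   avoid an equally long interval, or families of almost the same density that
   avoid an interval longer by one.  After a linear number of coordinates a linear
   interval is avoided, which contradicts isoperimetry in the cube.

   Upper bound.  Put z = x + y.  One query in uniform superposition, followed by a
   measurement, returns either a witness that z is not balanced, or a pair (a, b)
   with z_a <> z_b.  In the second case z restricted to the other n - 2 positions is
   constant on yes instances and balanced on no instances, which the
   Deutsch-Jozsa algorithm decides exactly during the second reading. *)

From HB Require Import structures.
Require Import Defs.
From mathcomp Require Import all_boot all_order all_algebra.
From mathcomp Require Import complex reals exp.
From mathcomp Require Import zify ring lra.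
Set Implicit Arguments.
Unset Strict Implicit.
Unset Printing Implicit Defensive.
Import Order.TTheory GRing.Theory Num.Theory.
Local Open Scope ring_scope.

(** * Families of vectors avoiding an intersection size *)

Definition common (s t : seq bool) : nat := count (fun p => p.1 && p.2) (zip s t).
Definition hdist (s t : seq bool) : nat := count (fun p => p.1 (+) p.2) (zip s t).
Definition weight (s : seq bool) : nat := count id s.

(** For words of one weight this turns a forbidden Hamming distance into a forbidden intersection
    size. *)
Lemma weight_common (s t : seq bool) : size s = size t ->
  (weight s + weight t = 2 * common s t + hdist s t)%N.
Proof.
rewrite /weight /common /hdist.
elim: s t => [|a s IH] [|b t] //= [/IH e].
by case: a; case: b => /=; lia.
Qed.

Definition section (m : nat) (b : bool) (S : {set m.+1.-tuple bool}) :
  {set m.-tuple bool} := [set s | cons_tuple b s \in S].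

Lemma card_sections (m : nat) (S : {set m.+1.-tuple bool}) :
  #|S| = (#|section false S| + #|section true S|)%N.
Proof.
pose c b : m.-tuple bool -> m.+1.-tuple bool := cons_tuple b.
have cI b : injective (c b) by move=> s t /(congr1 val) /= [] /val_inj.
rewrite -(card_imset _ (cI false)) -(card_imset _ (cI true)) -cardsUI.
have -> : (c false @: section false S) :&: (c true @: section true S) = set0.
  apply/setP=> x; rewrite !inE; apply/negP=> /andP[/imsetP[s _ ->]].
  by case/imsetP=> t _ /(congr1 val).
rewrite cards0 addn0; congr #|pred_of_set _|; apply/setP=> x; rewrite inE.
apply/idP/orP => [|[]/imsetP[s]]; last 2 first.
- by rewrite inE => h ->.
- by rewrite inE => h ->.
case/tupleP: x => -[] s sS; [right|left]; apply/imsetP; exists s => //;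
  by rewrite inE; move: sS; congr (_ \in _); apply: val_inj.
Qed.

(** * Numerical inequalities for the two sections of a family *)

Section SectionInequalities.
Variable R : realFieldType.

(** The one-coordinate case of the isoperimetric inequality: choosing different bits costs one unit
    of distance, so such a choice must satisfy a bound stronger by 17/16. *)
Lemma closest_sections_ineq (s t : bool -> R) :
  (forall b, 0 <= s b) -> (forall b, 0 <= t b) ->
  0 < s false + s true -> 0 < t false + t true ->
  exists a b, [/\ 0 < s a, 0 < t b &
    (17%:R / 16%:R) ^+ (a != b) * ((s false + s true) * (t false + t true))
      <= 1089%:R / 272%:R * (s a * t b)].
Proof.
move=> s_ge0 t_ge0.
have key (s0 s1 t0 t1 : R) : 0 <= s1 -> 0 <= t1 -> s1 <= s0 -> t1 <= t0 ->
    (s0 + s1) * (t0 + t1) <= 1089%:R / 272%:R * (s0 * t0) by nra.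
have := s_ge0 false; have := s_ge0 true.
have := t_ge0 false; have := t_ge0 true.
(* Index 0 is the larger section of each family, and the two larger sections carry opposite bits.
   Taking both costs the factor 17/16; replacing one by the smaller section makes the bits agree. *)
have key2 (s0 s1 t0 t1 : R) : 0 <= s1 -> 0 <= t1 -> s1 <= s0 -> t1 <= t0 ->
    0 < s0 -> 0 < t0 ->
    [\/ 17%:R / 16%:R * ((s0 + s1) * (t0 + t1)) <= 1089%:R / 272%:R * (s0 * t0),
        0 < t1 /\ (s0 + s1) * (t0 + t1) <= 1089%:R / 272%:R * (s0 * t1) |
        0 < s1 /\ (s0 + s1) * (t0 + t1) <= 1089%:R / 272%:R * (s1 * t0)].
  move=> s1p t1p s10 t10 s0p t0p.
  (* The threshold 16/17 balances the options: (33/17)^2 * 17/16 = (33/17) * (33/16) = 1089/272. *)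
  have [hs|hs] := leP (17%:R * s1) (16%:R * s0);
    have [ht|ht] := leP (17%:R * t1) (16%:R * t0).
  - apply: Or31.
    have : (s0 + s1) * (t0 + t1) <= (33%:R / 17%:R * s0) * (33%:R / 17%:R * t0).
      by apply: ler_pM; lra.
    by lra.
  - apply: Or32; split; first lra.
    have : (s0 + s1) * (t0 + t1) <= (33%:R / 17%:R * s0) * (33%:R / 16%:R * t1).
      by apply: ler_pM; lra.
    by lra.
  - apply: Or33; split; first lra.
    have : (s0 + s1) * (t0 + t1) <= (33%:R / 16%:R * s1) * (33%:R / 17%:R * t0).
      by apply: ler_pM; lra.
    by lra.
  have [h|h] := leP (s1 * t0) (t1 * s0).
  - apply: Or32; split; first lra.
    have h1 : 0 <= (17%:R * t1 - 16%:R * t0) * s0 by apply: mulr_ge0; lra.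
    have h2 : 0 <= (17%:R * s1 - 16%:R * s0) * (t0 - t1) by apply: mulr_ge0; lra.
    have h3 : 0 <= (17%:R * t1 - 16%:R * t0) * (s0 - s1) by apply: mulr_ge0; lra.
    by nra.
  - apply: Or33; split; first lra.
    have h1 : 0 <= (17%:R * s1 - 16%:R * s0) * t0 by apply: mulr_ge0; lra.
    have h2 : 0 <= (17%:R * t1 - 16%:R * t0) * (s0 - s1) by apply: mulr_ge0; lra.
    have h3 : 0 <= (17%:R * s1 - 16%:R * s0) * (t0 - t1) by apply: mulr_ge0; lra.
    by nra.
move=> t1 t0 s1 s0 sp tp.
have [hs|hs] := leP (s true) (s false); have [ht|ht] := leP (t true) (t false).
- exists false, false; split; [lra|lra|].
  by rewrite expr0 mul1r; apply: key.
- have [||||||h|[? h]|[? h]] := key2 (s false) (s true) (t true) (t false); try lra.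
  + exists false, true; rewrite expr1; split; lra.
  + exists false, false; rewrite expr0; split; lra.
  + exists true, true; rewrite expr0; split; lra.
- have [||||||h|[? h]|[? h]] := key2 (s true) (s false) (t false) (t true); try lra.
  + exists true, false; rewrite expr1; split; lra.
  + exists true, true; rewrite expr0; split; lra.
  + exists false, false; rewrite expr0; split; lra.
- exists true, true; split; [lra|lra|].
  by rewrite expr0 mul1r [s _ + _]addrC [t _ + _]addrC; apply: key => //; lra.
Qed.

(** To be used with [su], [si] the sizes of the union and intersection of the sections of S. If none
    of the first three products gains 2 percent, the sections are nearly balanced and those of S
    nearly coincide, so their intersection is still large. *)
Lemma gain_or_expand_ineq (s0 s1 su si t0 t1 tu : R) :
  0 <= s0 -> 0 <= s1 -> 0 <= si -> 0 <= t0 -> 0 <= t1 -> s0 <= su -> s1 <= su ->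
  su + si = s0 + s1 -> t0 + t1 <= 2 * tu ->
  let P := (s0 + s1) * (t0 + t1) in
  [\/ 51%:R / 50%:R * P <= 4 * (su * t0),
      51%:R / 50%:R * P <= 4 * (s0 * tu),
      51%:R / 50%:R * P <= 4 * (s1 * t1) |
      24%:R / 25%:R * P <= 4 * (si * t1)].
Proof.
move=> s0p s1p sip t0p t1p s0u s1u ui tu2 /=.
have [->|S0] := eqVneq (s0 + s1) 0.
  by apply: Or41; rewrite mul0r mulr0; apply: mulr_ge0 => //; apply: mulr_ge0; lra.
have [->|T0] := eqVneq (t0 + t1) 0.
  by apply: Or41; rewrite !mulr0; apply: mulr_ge0 => //; apply: mulr_ge0; lra.
pose S := s0 + s1; pose T := t0 + t1.
have Sp : 0 < S by rewrite /S lt_neqAle eq_sym S0 /=; lra.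
have Tp : 0 < T by rewrite /T lt_neqAle eq_sym T0 /=; lra.
(* Sizes are divided by S/2 and T/2, so that the two sections have average density 1. *)
have scale (c u v : R) : (c <= (2 * u / S) * (2 * v / T)) = (c * (S * T) <= 4 * (u * v)).
  rewrite -[RHS](ler_pM2r (x := (S * T)^-1)) ?invr_gt0 ?mulr_gt0 //.
  rewrite mulfK ?mulf_neq0 ?gt_eqF //; congr (_ <= _); field.
  by rewrite !gt_eqF.
rewrite -!scale.
have nn (u V : R) : 0 <= u -> 0 < V -> 0 <= 2 * u / V.
  by move=> ? ?; rewrite divr_ge0 ?mulr_ge0 // ltW.
have le2 (u v V : R) : u <= v -> 0 < V -> 2 * u / V <= 2 * v / V.
  by move=> ? ?; rewrite ler_pM2r ?invr_gt0 // ler_pM2l.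
have sumS : 2 * s0 / S + 2 * s1 / S = 2 by rewrite -mulrDl -mulrDr mulfK // gt_eqF.
have sumT : 2 * t0 / T + 2 * t1 / T = 2 by rewrite -mulrDl -mulrDr mulfK // gt_eqF.
have sumU : 2 * su / S + 2 * si / S = 2 by rewrite -mulrDl -mulrDr ui mulfK // gt_eqF.
have tu1 : 1 <= 2 * tu / T by rewrite ler_pdivlMr // mul1r.
move: (nn _ _ s0p Sp) (nn _ _ s1p Sp) (nn _ _ t0p Tp) (nn _ _ t1p Tp)
      (nn _ _ sip Sp) (le2 _ _ _ s0u Sp) (le2 _ _ _ s1u Sp) sumS sumT sumU tu1.
move: (2 * s0 / S) (2 * s1 / S) (2 * t0 / T) (2 * t1 / T) (2 * su / S)
      (2 * si / S) (2 * tu / T) => a0 a1 b0 b1 au ai bu.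
move=> a0p a1p b0p b1p aip a0u a1u sa sb su2 bu1.
have [h1|h1] := leP (51%:R / 50%:R) (au * b0); first exact: Or41.
have [h2|h2] := leP (51%:R / 50%:R) (a0 * bu); first exact: Or42.
have [h3|h3] := leP (51%:R / 50%:R) (a1 * b1); first exact: Or43.
apply: Or44; rewrite leNgt; apply/negP=> h4.
have ea : a0 < 51%:R / 50%:R by apply: le_lt_trans h2; nra.
have eb : b0 < 51%:R / 50%:R by apply: le_lt_trans h1; nra.
have eb1 : b1 < 105%:R / 100%:R.
  rewrite ltNge; apply/negP=> h.
  have : (98%:R / 100%:R) * (105%:R / 100%:R) <= a1 * b1 by apply: ler_pM; lra.
  by lra.
(* Adding [h1] and [h4] gives 2 - 2 (au - 1)(b1 - 1) < 198/100. As b1 < 1.05, this forces au > 1.2,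
   and then au * b0 is too large for [h1]. *)
have h5 : 1 / 100%:R < (au - 1) * (b1 - 1) by nra.
have h6 : 1 <= au by lra.
have h7 : 0 < b1 - 1.
  by rewrite ltNge; apply/negP=> h; have : (au - 1) * (b1 - 1) <= 0; [nra|lra].
have h8 : (au - 1) * (b1 - 1) <= (au - 1) * (5%:R / 100%:R).
  by apply: ler_wpM2l; lra.
have h9 : (12%:R / 10%:R) * (95%:R / 100%:R) <= au * b0 by apply: ler_pM; lra.
by lra.
Qed.

End SectionInequalities.

(** * Density increment for families avoiding an interval of intersection sizes *)

Section AvoidedIntersections.
Variable R : realFieldType.
(* An isoperimetric inequality; with q = 17/16 the base of the bound is
   1089/272 = (1 + q)^2 / q. *)
Lemma close_to_distance (m k : nat) (S T : {set m.-tuple bool}) :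
  (k <= m)%N -> S != set0 -> T != set0 ->
  exists s t d, [/\ s \in S, t \in T,
    (17%:R / 16%:R) ^+ d * (#|S|%:R * #|T|%:R) <= (1089%:R / 272%:R) ^+ m :> R,
    (hdist s t <= k + d)%N & (k <= hdist s t + d)%N].
Proof.
elim: m k S T => [|m IH] k S T km S0 T0.
  have card1 (A : {set 0.-tuple bool}) : (#|A| <= 1)%N.
    by apply: leq_trans (max_card _) _; rewrite card_tuple expn0.
  have [s sS] := set0Pn _ S0; have [t tT] := set0Pn _ T0.
  exists s, t, 0%N; rewrite expr0 mul1r expr0 -natrM lern1.
  have := leq_mul (card1 S) (card1 T); move: km; rewrite leqn0 => /eqP ->.
  have -> : hdist s t = 0%N by rewrite (tuple0 s) (tuple0 t).
  by move=> h; split; rewrite // -[1%N]mul1n.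
(* While k is positive, z asks for differing bits at this coordinate; complementing the bit of T by
   z reduces this to asking for equal bits. *)
have [z [k' [ek k'm]]] : exists (z : bool) k', k = (z + k')%N /\ (k' <= m)%N.
  by case: k km => [|k] km; [exists false, 0%N|exists true, k].
have pos (A : {set m.+1.-tuple bool}) : A != set0 ->
    0 < #|section false A|%:R + #|section true A|%:R :> R.
  by move=> ?; rewrite -natrD -card_sections ltr0n card_gt0.
have [|||| a [b [sa tb le_ab]]] := @closest_sections_ineq R
  (fun a => #|section a S|%:R) (fun b => #|section (b (+) z) T|%:R) => //=.
- exact: pos.
- by case: (z) => /=; [rewrite addrC|]; apply: pos.
have {}le_ab : (17%:R / 16%:R) ^+ (a != b) * (#|S|%:R * #|T|%:R) <=
    1089%:R / 272%:R * (#|section a S|%:R * #|section (b (+) z) T|%:R) :> R.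
  rewrite !(@card_sections m) !natrD; move: le_ab.
  by case: (z) => /=; rewrite // [X in _ * (_ * X)]addrC.
move: sa tb; rewrite !ltr0n !card_gt0 => sa tb.
have [s [t [d [sS tT bnd h1 h2]]]] := IH k' _ _ k'm sa tb.
exists (cons_tuple a s), (cons_tuple (b (+) z) t), ((a != b) + d)%N.
rewrite !inE in sS tT; split=> //.
- rewrite exprD -mulrA mulrCA.
  apply: (@le_trans _ _ ((17%:R / 16%:R) ^+ d *
    (1089%:R / 272%:R * (#|section a S|%:R * #|section (b (+) z) T|%:R)))).
    by rewrite ler_pM2l // exprn_gt0 //; lra.
  by rewrite mulrCA exprS; apply: ler_wpM2l => //; lra.
- rewrite ek /hdist /= -/(hdist s t); move: h1; clear.
  by case: a; case: b; case: z => /=; lia.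
- rewrite ek /hdist /= -/(hdist s t); move: h2; clear.
  by case: a; case: b; case: z => /=; lia.
Qed.

(* The intersection sizes w - c - e, ..., w - c are avoided. *)
Definition avoids (m : nat) (S T : {set m.-tuple bool}) (c e w : nat) : Prop :=
  forall s t, s \in S -> t \in T ->
  forall j, (j <= e)%N -> (common s t + c + j)%N != w.

(** The bound [w] stays fixed when coordinates are split off; [r] bounds the weight that the removed
    ones may have carried. *)
Definition weight_within (m : nat) (S : {set m.-tuple bool}) (r w : nat) : Prop :=
  forall s, s \in S -> (weight s <= w <= weight s + r)%N.

Lemma weight_within_section (m : nat) (S : {set m.+1.-tuple bool}) (r w : nat)
    (b : bool) (s : m.-tuple bool) :
  weight_within S r w -> s \in section b S -> (weight s <= w <= weight s + r.+1)%N.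
Proof.
by move=> h; rewrite inE => /h; rewrite /weight /=; case: b => /=; lia.
Qed.

(** Between layers of weights i and j, the avoided sizes are distances of one parity in an interval
    of radius e. A pair at distance within d of its centre therefore has d >= e. The factor (m+1)^2
    counts the pairs of layers. *)
Lemma avoids_dense_bound (m c e w r : nat) (S T : {set m.-tuple bool}) :
  avoids S T c e w -> weight_within S r w -> weight_within T r w ->
  (r <= c)%N -> (2 * c + e <= m)%N ->
  (17%:R / 16%:R) ^+ e * (#|S|%:R * #|T|%:R)
    <= m.+1%:R ^+ 2 * (1089%:R / 272%:R) ^+ m :> R.
Proof.
move=> av wS wT rc cm.
pose layer (A : {set m.-tuple bool}) (i : 'I_m.+1) := [set s in A | weight s == i].
have weight_lt (s : m.-tuple bool) : (weight s < m.+1)%N.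
  by rewrite ltnS -[X in (_ <= X)%N](size_tuple s) count_size.
have card_layers (A : {set m.-tuple bool}) : (#|A|%:R = \sum_i #|layer A i|%:R :> R).
  rewrite -natr_sum; congr _%:R.
  rewrite -sum1_card (partition_big (fun s => Ordinal (weight_lt s)) predT) //=.
  by apply: eq_bigr => i _; rewrite -sum1_card; apply: eq_bigl => s; rewrite inE.
rewrite 2!card_layers mulr_suml mulr_sumr.
have -> : m.+1%:R ^+ 2 * (1089%:R / 272%:R) ^+ m =
    \sum_(i < m.+1) \sum_(j < m.+1) (1089%:R / 272%:R) ^+ m :> R.
  by rewrite !sumr_const !card_ord -mulrnA -[RHS]mulr_natl natrM.
apply: ler_sum => i _; rewrite mulr_sumr mulr_sumr; apply: ler_sum => j _.
have bnd0 : 0 <= (1089%:R / 272%:R) ^+ m :> R by rewrite exprn_ge0 //; lra.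
have [->|S0] := eqVneq (layer S i) set0; first by rewrite cards0 mul0r mulr0.
have [->|T0] := eqVneq (layer T j) set0; first by rewrite cards0 !mulr0.
have [s0] := set0Pn _ S0; have [t0] := set0Pn _ T0.
rewrite !inE => /andP[/wT wj /eqP ej] /andP[/wS wi /eqP ei].
(* The target is the centre of the avoided distances. The subtraction is not truncated, since i and
   j are at least w - r and r <= c. *)
have km : (i + j + 2 * c + e - 2 * w <= m)%N by lia.
have [s [t [d [+ + bnd h1 h2]]]] := close_to_distance km S0 T0.
rewrite !inE => /andP[sS /eqP es] /andP[tT /eqP et].
apply: le_trans bnd; rewrite ler_pM2r; last first.
  by rewrite mulr_gt0 // ltr0n card_gt0.
apply: ler_weXn2l; first lra.
rewrite leqNgt; apply/negP => de.
have := @weight_common s t; rewrite !size_tuple => /(_ erefl) wc.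
have := av s t sS tT (w - c - common s t)%N.
by have: (w - c - common s t <= e)%N; lia.
Qed.

(* Since 24/25 * 17/16 = 51/50, the weight (17/16)^e makes the potential
   (17/16)^e |S| |T| / 4^n grow by 51/50 at each coordinate, whether the densities
   grow or the avoided interval does. *)
Lemma avoids_bound (k m c e w r n : nat) (S T : {set n.-tuple bool}) :
  n = (k + m)%N ->
  avoids S T c e w -> weight_within S r w -> weight_within T r w ->
  (r + k <= c)%N -> (2 * (c + k) + (e + k) <= m)%N ->
  (51%:R / 50%:R) ^+ k * ((17%:R / 16%:R) ^+ e * (#|S|%:R * #|T|%:R))
    <= 4%:R ^+ k * (m.+1%:R ^+ 2 * (1089%:R / 272%:R) ^+ m) :> R.
Proof.
elim: k c e r n S T => [|k IH] c e r n S T en av wS wT rc cm.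
  rewrite add0n in en; subst n.
  rewrite !expr0 !mul1r; apply: (avoids_dense_bound av wS wT); lia.
case: n S T en av wS wT => [|n] S T // [en] av wS wT.
set bnd := (X in _ <= _ * X).
have step c' e' (S' T' : {set n.-tuple bool}) :
    avoids S' T' c' e' w -> (c <= c' <= c.+1)%N -> (e <= e' <= e.+1)%N ->
    weight_within S' r.+1 w -> weight_within T' r.+1 w ->
    51%:R / 50%:R * (#|S|%:R * #|T|%:R) <=
      4%:R * ((17%:R / 16%:R) ^+ (e' - e) * (#|S'|%:R * #|T'|%:R)) :> R ->
    (51%:R / 50%:R) ^+ k.+1 * ((17%:R / 16%:R) ^+ e * (#|S|%:R * #|T|%:R))
      <= 4%:R ^+ k.+1 * bnd.
  move=> av' cc' ee' wS' wT' h.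
  have {}IH := IH c' e' r.+1 n S' T' en av' wS' wT'.
  apply: (@le_trans _ _ (4%:R * ((51%:R / 50%:R) ^+ k *
    ((17%:R / 16%:R) ^+ e' * (#|S'|%:R * #|T'|%:R))))); last first.
    by rewrite exprS -mulrA ler_pM2l //; apply: IH; lia.
  have -> : e' = (e + (e' - e))%N by lia.
  move: h; rewrite (exprS _ k) (exprD _ e (e' - e)).
  move: (#|S|%:R * #|T|%:R) (#|S'|%:R * #|T'|%:R) => P P'.
  have : 0 <= (51%:R / 50%:R) ^+ k * (17%:R / 16%:R) ^+ e :> R.
    by rewrite mulr_ge0 // exprn_ge0 //; lra.
  move: ((51%:R / 50%:R : R) ^+ k) => u; move: (51%:R / 50%:R : R) => v.
  move: ((17%:R / 16%:R : R) ^+ (e' - e)) ((17%:R / 16%:R : R) ^+ e) => y x xu h.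
  have -> : v * u * (x * P) = u * x * (v * P) by ring.
  have -> : 4 * (u * (x * y * P')) = u * x * (4 * (y * P')) by ring.
  exact: ler_wpM2l.
pose S0 := section false S; pose S1 := section true S.
pose T0 := section false T; pose T1 := section true T.
have wsec (A : {set n.+1.-tuple bool}) b : weight_within A r w ->
    weight_within (section b A) r.+1 w.
  by move=> wA s; apply: weight_within_section wA.
have wU (A B : {set n.-tuple bool}) : weight_within A r.+1 w ->
    weight_within B r.+1 w -> weight_within (A :|: B) r.+1 w.
  by move=> wA wB s; rewrite inE => /orP[/wA|/wB].
have wI (A B : {set n.-tuple bool}) : weight_within A r.+1 w ->
    weight_within (A :&: B) r.+1 w.
  by move=> wA s; rewrite inE => /andP[/wA].
have cS : #|S|%:R = #|S0|%:R + #|S1|%:R :> R by rewrite card_sections natrD.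
have cT : #|T|%:R = #|T0|%:R + #|T1|%:R :> R by rewrite card_sections natrD.
have [||||||||||||] := @gain_or_expand_ineq R #|S0|%:R #|S1|%:R
  #|S0 :|: S1|%:R #|S0 :&: S1|%:R #|T0|%:R #|T1|%:R #|T0 :|: T1|%:R => //.
- by rewrite ler_nat subset_leq_card ?subsetUl.
- by rewrite ler_nat subset_leq_card ?subsetUr.
- by rewrite -!natrD cardsUI.
- rewrite -natrM -natrD ler_nat mul2n -addnn.
  by apply: leq_add; rewrite subset_leq_card ?subsetUl ?subsetUr.
(* A bit 0 in T adds nothing to the intersection, so both sections of S can be merged; the next case
   exchanges the roles. *)
- rewrite -cS -cT => h; apply: (step c e (S0 :|: S1) T0); rewrite ?leqnn ?leqnSn //.
  + move=> s t; rewrite !inE => /orP[] sS tT j /(av _ _ sS tT);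
    by rewrite /common /=.
  + by apply: wU; apply: wsec.
  + exact: wsec.
  + by rewrite subnn expr0 mul1r.
- rewrite -cS -cT => h; apply: (step c e S0 (T0 :|: T1)); rewrite ?leqnn ?leqnSn //.
  + move=> s t; rewrite !inE => sS /orP[] tT j /(av _ _ sS tT);
    by rewrite /common /=.
  + exact: wsec.
  + by apply: wU; apply: wsec.
  + by rewrite subnn expr0 mul1r.
(* Two bits 1 add one to the intersection, which [c.+1] records. *)
- rewrite -cS -cT => h; apply: (step c.+1 e S1 T1); rewrite ?leqnn ?leqnSn //.
  + move=> s t; rewrite !inE => sS tT j /(av _ _ sS tT).
    by rewrite /common /= !addnS !addSn.
  + exact: wsec.
  + exact: wsec.
  + by rewrite subnn expr0 mul1r.
(* A word in both sections of S extends by 0 and by 1; against a bit 1 in T this excludes the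
   interval and its shift by one. *)
- rewrite -cS -cT => h; apply: (step c e.+1 (S0 :&: S1) T1); rewrite ?leqnn ?leqnSn //.
  + move=> s t; rewrite !inE => /andP[s0 s1] tT j.
    rewrite leq_eqVlt => /orP[/eqP->|]; last by rewrite ltnS => /(av _ _ s0 tT).
    by have := av _ _ s1 tT e (leqnn e); rewrite /common /= !addnS !addSn.
  + by apply: wI; apply: wsec.
  + exact: wsec.
  + rewrite subSn // subnn expr1; lra.
Qed.

End AvoidedIntersections.

(** * The lower bound for 1DFA *)

Lemma hamming_hdist (n : nat) (x y : n.-tuple bool) : hamming x y = hdist x y.
Proof.
rewrite /hamming -sum1_card big_mkcond /=.
elim: n x y => [|n IH] x y; first by rewrite big_ord0 (tuple0 x) (tuple0 y).
case/tupleP: x => a x; case/tupleP: y => b y.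
rewrite big_ord_recl inE /= !tnth0 /hdist /= -/(hdist x y) -IH.
congr addn; first by case: a; case: b.
by apply: eq_bigr => i _; rewrite !inE !tnthS.
Qed.

Lemma pigeonhole (A B : finType) (f : A -> B) (a0 : A) :
  exists b, (#|A| <= #|B| * #|[set a | f a == b]|)%N.
Proof.
pose F b := #|[set a | f a == b]|.
exists [arg max_(b > f a0) F b]; case: arg_maxnP => // b _ max_b.
apply: (@leq_trans (\sum_(c : B) F b)); last by rewrite sum_nat_const.
rewrite -sum1_card (partition_big f predT) //=.
by apply: leq_sum => c _; rewrite sum1dep_card; apply: (max_b c).
Qed.

Section DFA.
Variable D : dfa letter.
Local Notation run := (foldl (@dfa_trans letter D)).

Definition transcript (n : nat) (x y : n.-tuple bool) :
    dfa_state D * dfa_state D * dfa_state D :=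
  let s1 := run (dfa_s0 D) (bits x ++ [:: sharp]) in
  let s2 := run s1 (bits y ++ [:: sharp; sharp]) in
  let s3 := run s2 (bits x ++ [:: sharp]) in (s1, s2, s3).

(* Words with the same transcript form a combinatorial rectangle. *)
Lemma transcript_cross (n : nat) (x y x' y' : n.-tuple bool) :
  transcript x y = transcript x' y' ->
  dfa_accepts D (xyxy x y') = dfa_accepts D (xyxy x' y').
Proof.
rewrite /transcript /dfa_accepts /xyxy !foldl_cat /= => -[e1 e2 e3].
by move: e2 e3; rewrite e1 => e2; rewrite e2 => ->.
Qed.

(** With n = p+1, each (0t, bt) is a yes instance, so crossing within a class makes (0s, bt)
    accepted and hence not at distance n/2. Equal weights force even distances between s and t; the
    excluded one, n/2 - b = 2 floor(n/4), is the intersection size w - floor(n/4). *)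
Lemma dfa_large_class (p : nat) : dfa_solves D (problem_A p.+1) -> ~~ odd p.+1 ->
  exists (A : {set p.-tuple bool}) (w : nat),
    [/\ (2 ^ p <= #|dfa_state D| ^ 3 * p.+1 * #|A|)%N,
        avoids A A (p.+1 %/ 4) 0 w & weight_within A 0 w].
Proof.
move=> [acc rej] even_n.
pose b := odd p.+1./2.
have weight_lt (s : p.-tuple bool) : (weight s < p.+1)%N.
  by rewrite ltnS -[X in (_ <= X)%N](size_tuple s) count_size.
pose X (x : p.-tuple bool) : p.+1.-tuple bool := cons_tuple false x.
pose Y (x : p.-tuple bool) : p.+1.-tuple bool := cons_tuple b x.
have [[tr w]] := pigeonhole (fun x => (transcript (X x) (Y x), Ordinal (weight_lt x)))
  [tuple of nseq p false].
rewrite card_tuple card_bool !card_prod card_ord => cardA.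
exists [set x | (transcript (X x) (Y x), Ordinal (weight_lt x)) == (tr, w)], w.
split; first by rewrite !expnS expn0 muln1 mulnA.
  move=> s t; rewrite !inE !xpair_eqE => /andP[/eqP es /eqP ws] /andP[/eqP et /eqP wt].
  move=> j; rewrite leqn0 => /eqP ->; rewrite addn0; apply/negP => /eqP h.
  have hXY (u v : p.-tuple bool) : hamming (X u) (Y v) = (b + hdist u v)%N.
    by rewrite hamming_hdist.
  have := @weight_common s t; rewrite !size_tuple => /(_ erefl).
  move/(congr1 val): ws => /= ->; move/(congr1 val): wt => /= -> hw.
  have : dfa_accepts D (xyxy (X s) (Y t)).
    rewrite (@transcript_cross _ (X s) (Y s) (X t)) ?es ?et //.
    apply: acc; exists (X t), (Y t); split=> //; rewrite hXY.
    have -> : hdist t t = 0%N.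
      by rewrite /hdist; elim: (val t) => //= a l ->; rewrite addbb.
    by rewrite addn0; case: (b).
  apply/negP; apply: rej; exists (X s), (Y t); split=> //; rewrite hXY.
  pose cm := common s t; pose hd := hdist s t.
  have {}h : (cm + p.+1 %/ 4 = w)%N := h.
  have {}hw : (w + w = 2 * cm + hd)%N := hw.
  rewrite -/hd /b; move: h hw even_n; move: cm hd (nat_of_ord w) => cm hd v; clear.
  lia.
by move=> s; rewrite inE xpair_eqE => /andP[_ /eqP/(congr1 val) /= ->]; rewrite addn0 leqnn.
Qed.

(** The words with x = y = 0^n and with x = 0^n, y of weight n/2 must end in different states. The
    bound lets powers of K absorb constants later. *)
Lemma dfa_card_gt1 (n : nat) : dfa_solves D (problem_A n) -> (1 < #|dfa_state D|)%N.
Proof.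
move=> [acc rej].
pose x : n.-tuple bool := [tuple false | i < n].
pose y : n.-tuple bool := [tuple (i < n./2)%N | i < n].
have hx : dfa_accepts D (xyxy x x).
  apply: acc; exists x, x; split=> //.
  by rewrite (_ : hamming x x = 0%N) // /hamming; apply: eq_card0 => i; rewrite !inE eqxx.
have hy : ~~ dfa_accepts D (xyxy x y).
  apply: rej; exists x, y; split=> //; rewrite /hamming.
  rewrite (eq_card (B := [set i : 'I_n | (i < n./2)%N])); last first.
    by move=> i; rewrite !inE !tnth_mktuple; case: ltnP.
  have le_n : (n./2 <= n)%N by rewrite -{2}[n]odd_double_half -addnn; lia.
  have wI : injective (widen_ord le_n) by move=> i j /(congr1 val) /= /val_inj.
  rewrite -[RHS](card_ord n./2) -(card_imset _ wI).
  apply: eq_card => i; rewrite !inE; apply/idP/imsetP => [lt_i|[j _ ->]]; last exact: (ltn_ord j).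
  by exists (Ordinal lt_i) => //; apply: val_inj.
apply: leq_trans (max_card (mem [set run (dfa_s0 D) (xyxy x x); run (dfa_s0 D) (xyxy x y)])).
rewrite cards2; case: eqP => // e.
by move: hy; rewrite /dfa_accepts -e -/(dfa_accepts D (xyxy x x)) hx.
Qed.

End DFA.

(** * From the density bound to exponentially many states *)

Section StateBound.
Variable R : realType.

Lemma succ_le_geometric (N : nat) : N.+1%:R <= 1000%:R * (1001%:R / 1000%:R) ^+ N :> R.
Proof.
elim: N => [|N IH]; first by rewrite expr0; lra.
have : 1 <= (1001%:R / 1000%:R) ^+ N :> R by apply: exprn_ege1; lra.
by rewrite exprS -(natr1 N.+1); lra.
Qed.

(** The gain (51/50)^N over a fraction of the coordinates outweighs the loss (1089/1088)^m and the
    polynomial factors, so a power of K must make up the difference. *)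
Lemma dfa_power_bound (n : nat) (D : dfa letter) : ~~ odd n ->
  dfa_solves D (problem_A n) ->
  (1008%:R / 1000%:R) ^+ n <= #|dfa_state D|%:R ^+ 473 :> R.
Proof.
move=> even_n sol; have K2 := dfa_card_gt1 sol.
set K : R := #|dfa_state D|%:R.
have K2' : 2%:R <= K by rewrite ler_nat.
case: n even_n sol => [|p] even_n sol.
  by rewrite expr0; apply: exprn_ege1; lra.
have [A [w [cardA avA wA]]] := dfa_large_class sol even_n.
(* With c = floor((p+1)/4) and e = 0 the last side condition of [avoids_bound] reads 2c + 4N <= p,
   which this N meets because p is odd. *)
pose N := (p %/ 8)%N; pose m := (p - N)%N.
have Np : (N <= p)%N by rewrite leq_div.
have := @avoids_bound R N m (p.+1 %/ 4) 0 w 0 p A A.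
rewrite subnKC // expr0 mul1r => /(_ erefl avA wA wA) bnd.
have {}bnd : (51%:R / 50%:R) ^+ N * (#|A|%:R * #|A|%:R)
    <= 4%:R ^+ N * (m.+1%:R ^+ 2 * (1089%:R / 272%:R) ^+ m) :> R.
  by apply: bnd; move: even_n; rewrite /m /N; clear; lia.
have key : (51%:R / 50%:R) ^+ N <= K ^+ 6 * p.+1%:R ^+ 4 * (1089%:R / 1088%:R) ^+ m.
  have A_ge : 2%:R ^+ p <= K ^+ 3 * p.+1%:R * #|A|%:R.
    by rewrite -!natrX -!natrM ler_nat.
  have A_ge2 : 4%:R ^+ p <= K ^+ 6 * p.+1%:R ^+ 2 * (#|A|%:R * #|A|%:R).
    have -> : 4%:R = 2%:R * 2%:R :> R by rewrite -natrM.
    rewrite exprMn; apply: le_trans (ler_pM _ _ A_ge A_ge) _; rewrite ?exprn_ge0 //.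
    by rewrite le_eqVlt; apply/orP; left; apply/eqP; ring.
  have -> : 1089%:R / 1088%:R = 1089%:R / 272%:R / 4%:R :> R by lra.
  rewrite [(_ / 4%:R) ^+ m]expr_div_n mulrA ler_pdivlMr ?exprn_gt0 //.
  have pN : 0 < 4%:R ^+ N :> R by rewrite exprn_gt0.
  rewrite -(ler_pM2r pN) -[leLHS]mulrA -exprD subnK //.
  apply: le_trans (ler_wpM2l _ A_ge2) _; first by rewrite exprn_ge0 //; lra.
  rewrite mulrCA.
  have nn : 0 <= K ^+ 6 * p.+1%:R ^+ 2 by rewrite mulr_ge0 ?exprn_ge0 //; lra.
  apply: le_trans (ler_wpM2l nn bnd) _.
  have mp : m.+1%:R ^+ 2 <= p.+1%:R ^+ 2 :> R.
    by rewrite lerXn2r ?nnegrE ?ler_nat // ltnS leq_subr.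
  have LN : 0 <= (1089%:R / 272%:R) ^+ m * 4%:R ^+ N :> R.
    by rewrite mulr_ge0 ?exprn_ge0 //; lra.
  have := ler_wpM2l nn (ler_wpM2r LN mp).
  move: ((1089%:R / 272%:R : R) ^+ m) (4%:R ^+ N : R) (p.+1%:R : R) (m.+1%:R : R) => L F P M.
  by clear; move: (K) => k; lra.
have ge0X (x : R) k : 0 <= x -> 0 <= x ^+ k by move=> ?; rewrite exprn_ge0.
(* Here p + 1 <= 8 (N+1) and m <= 7 (N+1), while 1.001^4 < 1.0041 and (1089/1088)^7 < 1.007. *)
have {}key : (51%:R / 50%:R) ^+ N <= K ^+ 6 * (8000%:R ^+ 4 * (10041%:R / 10000%:R) ^+ N)
    * (2%:R * (1007%:R / 1000%:R) ^+ N).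
  apply: le_trans key _; apply: ler_pM; rewrite ?mulr_ge0 ?ge0X //; try lra.
    apply: ler_wpM2l; first by rewrite ge0X //; lra.
    have h : p.+1%:R <= 8000%:R * (1001%:R / 1000%:R) ^+ N :> R.
      apply: (@le_trans _ _ (8%:R * N.+1%:R)).
        by rewrite -natrM ler_nat /N; clear; lia.
      by have := succ_le_geometric N; lra.
    apply: (@le_trans _ _ ((8000%:R * (1001%:R / 1000%:R) ^+ N) ^+ 4)).
      by rewrite lerXn2r ?nnegrE // mulr_ge0 // ge0X //; lra.
    rewrite exprMn -exprM mulnC exprM ler_wpM2l ?ge0X //.
    rewrite lerXn2r ?nnegrE ?ge0X //; lra.
  apply: (@le_trans _ _ ((1089%:R / 1088%:R) ^+ (7 * N.+1))).
    by apply: ler_weXn2l; [lra|rewrite /m /N; clear; lia].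
  apply: (@le_trans _ _ ((1007%:R / 1000%:R) ^+ N.+1)).
    by rewrite exprM lerXn2r ?nnegrE ?ge0X //; lra.
  by rewrite exprS ler_wpM2r ?ge0X //; lra.
(* The product 1.008 * 1.0041 * 1.007 is below 51/50, and 2 * 8000^4 is below 2^53; hence 59 = 6 +
   53. *)
have bN : (1008%:R / 1000%:R) ^+ N <= K ^+ 59.
  have pos : 0 < (10041%:R / 10000%:R) ^+ N * (1007%:R / 1000%:R) ^+ N :> R.
    by rewrite mulr_gt0 // exprn_gt0 //; lra.
  rewrite -(ler_pM2r pos) -!exprMn.
  apply: (@le_trans _ _ ((51%:R / 50%:R) ^+ N)).
    by rewrite lerXn2r ?nnegrE //; lra.
  apply: (le_trans key); rewrite exprMn.
  have -> : K ^+ 59 = K ^+ 6 * K ^+ 53 by rewrite -exprD.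
  have K53 : 8000%:R ^+ 4 * 2%:R <= K ^+ 53.
    apply: (@le_trans _ _ (2%:R ^+ 53)); last by rewrite lerXn2r ?nnegrE //; lra.
    by lra.
  have := ler_wpM2l (ge0X K 6 _) (ler_wpM2r (ltW pos) K53).
  move: ((10041%:R / 10000%:R : R) ^+ N) ((1007%:R / 1000%:R : R) ^+ N).
  move: (K ^+ 6) (K ^+ 53) (8000%:R ^+ 4) => a b c x y h.
  have {}h := h ltac:(lra).
  by move: h; clear; lra.
(* Since p + 1 <= 8N + 8 and 1.008^8 < 2 <= K, the exponent is 8 * 59 + 1 = 473. *)
apply: (@le_trans _ _ ((1008%:R / 1000%:R) ^+ (N * 8 + 8))).
  by apply: ler_weXn2l; [lra|rewrite /N; clear; lia].
have -> : K ^+ 473 = (K ^+ 59) ^+ 8 * K by rewrite -exprM -exprSr.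
rewrite exprD exprM; apply: ler_pM; rewrite ?ge0X //; try lra.
by rewrite lerXn2r ?nnegrE ?ge0X //; lra.
Qed.

Lemma dfa_lower_bound : exists c : R, 0 < c /\
  forall n : nat, ~~ odd n -> forall D : dfa letter,
    dfa_solves D (problem_A n) -> 2 `^ (c * n%:R) <= #|dfa_state D|%:R.
Proof.
pose beta : R := 1008%:R / 1000%:R.
have beta1 : 1 < beta by rewrite /beta; lra.
have ln2 : 0 < ln 2%:R :> R by rewrite ln_gt0 // ltr1n.
(* With this constant c, 2^(c n) is the 473rd root of beta^n. *)
exists (ln beta / (473%:R * ln 2%:R)); split.
  by rewrite divr_gt0 ?ln_gt0 // mulr_gt0.
move=> n even_n D sol; have K2 := dfa_card_gt1 sol.
have K0 : 0 < #|dfa_state D|%:R :> R by rewrite ltr0n ltnW.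
rewrite /powR pnatr_eq0 /= -[leRHS]lnK ?posrE // ler_expR.
rewrite (_ : _ * ln 2 = ln beta * n%:R / 473%:R); last first.
  by field; rewrite gt_eqF //= pnatr_eq0.
rewrite ler_pdivrMr // !mulr_natr -!lnXn ?(lt_trans _ beta1) //.
by rewrite ler_ln ?posrE ?exprn_gt0 ?(lt_trans _ beta1) //; apply: dfa_power_bound.
Qed.

End StateBound.

(** * Runs of a 1QCFA with a certain outcome *)

Section Norm.
Local Open Scope complex_scope.
Local Open Scope sesquilinear_scope.
Variables (R : realType) (d : nat).
Implicit Types (U P : 'M[R[i]]_d) (v : 'cV[R[i]]_d).

Lemma qnorm_sqr v : (qnorm v ^+ 2)%:C = (v ^t* *m v) 0 0.
Proof.
rewrite /qnorm sqr_sqrtr; last by apply: sumr_ge0 => i _; rewrite sqr_ge0.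
rewrite rmorph_sum mxE; apply: eq_bigr => i _.
by rewrite rmorphXn /= !mxE mulrC -normCK.
Qed.

Lemma qnorm_ge0 v : 0 <= qnorm v.
Proof. exact: sqrtr_ge0. Qed.

Lemma qnormZ (a : R) v : qnorm (a%:C *: v) ^+ 2 = a ^+ 2 * qnorm v ^+ 2.
Proof.
apply: complexI; rewrite [RHS]rmorphM /= !qnorm_sqr.
have -> : (a%:C *: v) ^t* = a%:C *: v ^t*.
  by apply/matrixP=> i j; rewrite !mxE rmorphM; congr (_ * _); apply: conjc_real.
by rewrite -scalemxAl -scalemxAr scalerA mxE rmorphXn /= expr2.
Qed.

Lemma adjoint_mul P v : (P *m v) ^t* = v ^t* *m P ^t*.
Proof. by rewrite trmx_mul map_mxM. Qed.

Lemma qnorm_unitary U v : U \is unitarymx -> qnorm (U *m v) ^+ 2 = qnorm v ^+ 2.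
Proof.
move=> /unitarymxP/mulmx1C UU; apply: complexI.
by rewrite !qnorm_sqr adjoint_mul mulmxA -(mulmxA _ _ U) UU mulmx1.
Qed.

Lemma qnorm_measurement (C : finType) (P : C -> 'M[R[i]]_d) v :
  projective_measurement P -> \sum_c qnorm (P c *m v) ^+ 2 = qnorm v ^+ 2.
Proof.
move=> [herm idem _ total]; apply: complexI; rewrite rmorph_sum /= qnorm_sqr.
transitivity ((v ^t* *m (\sum_c P c *m v)) 0 0); last by rewrite -mulmx_suml total mul1mx.
rewrite mulmx_sumr summxE.
apply: eq_bigr => c _; rewrite qnorm_sqr adjoint_mul herm.
by rewrite mulmxA -(mulmxA _ _ (P c)) idem mulmxA.
Qed.

End Norm.

Section Certain.
Local Open Scope complex_scope.
Local Open Scope sesquilinear_scope.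
Variables (R : realType) (Sigma : finType) (M : qcfa R Sigma).
Implicit Types (F : {set qcfa_cstate M}) (phi : 'cV[R[i]]_#|qcfa_qstate M|).

(* The quantum state is not renormalised, which keeps the run linear in phi. *)
Fixpoint certain F (u : seq (tape_sym Sigma)) (s : qcfa_cstate M) phi : Prop :=
  match u with
  | [::] => phi != 0 -> s \in F
  | g :: u' =>
      if s \in qcfa_acc M :|: qcfa_rej M then certain F u' s phi else
      forall c, certain F u' (qcfa_trans s g c)
                  (qcfa_meas s g c *m (qcfa_op s g *m phi))
  end.

Lemma certain0 F u s : certain F u s 0.
Proof.
elim: u s => [|g u IH] s /=; first by rewrite eqxx.
by case: ifP => _ // c; rewrite !mulmx0.
Qed.

Lemma certainZ F u s (a : R[i]) phi : certain F u s phi -> certain F u s (a *: phi).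
Proof.
have [->|a0] := eqVneq a 0; first by rewrite scale0r => _; apply: certain0.
elim: u s phi => [|g u IH] s phi /=.
  by move=> h; rewrite scaler_eq0 negb_or => /andP[_]; apply: h.
by case: ifP => _; [exact: IH|move=> h c; rewrite -!scalemxAr; apply: IH].
Qed.

Lemma certain_halt F u s phi :
  s \in qcfa_acc M :|: qcfa_rej M -> s \in F -> certain F u s phi.
Proof. by move=> hs sF; elim: u => //= g u IH; rewrite hs. Qed.

(** Certainty survives the renormalisation by [certainZ], outcomes of norm 0 contribute nothing, and
    the remaining probabilities sum to the squared norm 1. *)
Lemma certain_prob F u s phi :
  certain F u s phi -> qnorm phi = 1 -> qcfa_prob F u s phi = 1.
Proof.
elim: u s phi => [|g u IH] s phi /=.
  move=> h n1; rewrite h //; apply/eqP => phi0; move: n1; rewrite phi0.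
  move/(congr1 (fun x => x ^+ 2)) => /(congr1 (fun x => x%:C)).
  by rewrite qnorm_sqr mulmx0 mxE expr1n => /esym/eqP; rewrite oner_eq0.
case: ifP => [_|nh]; first exact: IH.
move=> h n1.
have <- : \sum_c qnorm (qcfa_meas s g c *m (qcfa_op s g *m phi)) ^+ 2 = 1.
  rewrite qnorm_measurement; last exact: qcfa_meas_proj.
  by rewrite qnorm_unitary ?n1 ?expr1n // qcfa_op_unitary // nh.
apply: eq_bigr => c _; set psi := qcfa_meas _ _ _ *m _.
have [->|q0] := eqVneq (qnorm psi) 0; first by rewrite expr0n mul0r.
rewrite IH ?mulr1 //; first exact/certainZ/h.
apply/eqP; rewrite -(eqrXn2 (n := 2)) ?qnorm_ge0 //.
by rewrite qnormZ expr1n exprVn mulVf // expf_neq0.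
Qed.

End Certain.

(** * The two-query automaton *)

Section Reflection.
Variables (R : comPzRingType) (d k : nat).

(** For isometries J and W with orthogonal ranges, (J - W)/sqrt 2 is again an isometry, and this is
    a block Householder reflection: an orthogonal involution exchanging J and W. It extends an
    action prescribed on few vectors to a unitary. *)
Definition reflection (J W : 'M[R]_(d, k)) : 'M[R]_d :=
  1%:M - (J - W) *m (J - W)^T.

Variables J W : 'M[R]_(d, k).
Hypotheses (JJ : J^T *m J = 1%:M) (WW : W^T *m W = 1%:M) (WJ : W^T *m J = 0).

Let JW : J^T *m W = 0.
Proof. by rewrite -[LHS]trmxK trmx_mul trmxK WJ trmx0. Qed.

Lemma tr_reflection : (reflection J W)^T = reflection J W.
Proof. by rewrite /reflection linearB /= trmx1 trmx_mul trmxK. Qed.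

Lemma reflectionJ : reflection J W *m J = W.
Proof.
have GJ : (J - W)^T *m J = 1%:M by rewrite linearB /= mulmxBl JJ WJ subr0.
rewrite /reflection mulmxBl mul1mx -mulmxA GJ mulmx1.
by rewrite opprB addrC subrK.
Qed.

Lemma reflectionW : reflection J W *m W = J.
Proof.
have GW : (J - W)^T *m W = - 1%:M by rewrite linearB /= mulmxBl WW JW sub0r.
rewrite /reflection mulmxBl mul1mx -mulmxA GW mulmxN mulmx1.
by rewrite opprK addrC subrK.
Qed.

Lemma reflectionK : reflection J W *m (reflection J W)^T = 1%:M.
Proof.
rewrite tr_reflection {2}/reflection mulmxBr mulmx1 mulmxA mulmxBr reflectionJ reflectionW.
by rewrite /reflection -[W - J]opprB mulNmx opprK subrK.
Qed.

End Reflection.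

(** [Prepare] handles the second of the two adjacent [#], where the superposition for the second
    reading is set up. *)
Inductive phase := ReadX1 | ReadY1 | Prepare | ReadX2 | ReadY2.

Definition phase_code (p : phase) : 'I_5 :=
  match p with
  | ReadX1 => inord 0 | ReadY1 => inord 1 | Prepare => inord 2
  | ReadX2 => inord 3 | ReadY2 => inord 4
  end.
Definition phase_decode (i : 'I_5) : phase :=
  match val i with
  | 0 => ReadX1 | 1 => ReadY1 | 2 => Prepare | 3 => ReadX2 | _ => ReadY2
  end%N.
Lemma phase_codeK : cancel phase_code phase_decode.
Proof. by case; rewrite /phase_decode /= inordK. Qed.

HB.instance Definition _ := Equality.copy phase (can_type phase_codeK).
HB.instance Definition _ := Choice.copy phase (can_type phase_codeK).
HB.instance Definition _ := Countable.copy phase (can_type phase_codeK).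
HB.instance Definition _ := Finite.copy phase (can_type phase_codeK).

Lemma card_phase : (#|{: phase}| <= 5)%N.
Proof. by rewrite -[5%N]card_ord; apply: (leq_card _ (can_inj phase_codeK)). Qed.

Lemma sum_option (R : nmodType) (T : finType) (F : option T -> R) :
  \sum_o F o = F None + \sum_t F (Some t).
Proof.
rewrite (bigD1 None) //=; congr (_ + _).
rewrite (reindex_omap Some id) /=; last by case.
by apply: eq_bigl => t; rewrite eqxx.
Qed.

Lemma sum_indicator (R : pzSemiRingType) (T : finType) (t : T) (F : T -> R) :
  \sum_s (s == t)%:R * F s = F t.
Proof.
rewrite (bigD1 t) //= eqxx mul1r big1 ?addr0 // => s /negbTE ->.
by rewrite mul0r.
Qed.

(** * Operators, control and correctness of the automaton *)

Section Machine.
Local Open Scope complex_scope.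
Local Open Scope sesquilinear_scope.
Variables (R : realType) (n : nat).
Hypothesis n_ge4 : (4 <= n)%N.

(** The states [inl i] carry the phases of the positions; the states [inr _] are the answers of the
    query and the starting points of the superpositions. *)
Local Notation Q := ('I_n + option ('I_n * 'I_n))%type.
Local Notation real_mx := (map_mx (real_complex R)).

Lemma sum_enum (F : Q -> R) : \sum_(k < #|{: Q}|) F (enum_val k) = \sum_q F q.
Proof. by rewrite -(big_enum_val F). Qed.

Definition ket (q : Q) : 'cV[R]_#|{: Q}| := \col_k (enum_val k == q)%:R.

Definition embed : 'M[R]_(#|{: Q}|, n) :=
  \matrix_(k, i) (enum_val k == inl i)%:R.

(* Amplitudes of the first query: from the phase vector (x_i)/sqrt n they
   produce (sum_i x_i)/n on None and (x_a - x_b)/(n sqrt 2) on (a, b). *)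
Definition query_amp (q : Q) (i : 'I_n) : R :=
  match q with
  | inl _ => 0
  | inr None => (Num.sqrt n%:R)^-1
  | inr (Some (a, b)) => ((a == i)%:R - (b == i)%:R) / Num.sqrt (2 * n%:R)
  end.

Definition query_mx : 'M[R]_(#|{: Q}|, n) :=
  \matrix_(k, i) query_amp (enum_val k) i.

Definition index_set (e : option ('I_n * 'I_n)) : {set 'I_n} :=
  if e is Some (a, b) then ~: [set a; b] else setT.

Definition uniform (e : option ('I_n * 'I_n)) : 'cV[R]_n :=
  \col_k ((k \in index_set e)%:R / Num.sqrt #|index_set e|%:R).

Lemma index_set_gt0 e : (0 < #|index_set e|)%N.
Proof.
case: e => [[a b]|] /=; last by rewrite cardsT card_ord; lia.
rewrite -(ltn_add2l #|[set a; b]|) addn0 cardsC card_ord cards2.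
by case: (a != b) => /=; lia.
Qed.

Lemma uniform_norm e : (uniform e)^T *m uniform e = 1%:M.
Proof.
apply/matrixP => i j; rewrite !ord1 mxE mxE eqxx.
have K0 : 0 < #|index_set e|%:R :> R by rewrite ltr0n index_set_gt0.
transitivity (\sum_(k in index_set e) #|index_set e|%:R^-1 : R); last first.
  by rewrite sumr_const -[LHS]mulr_natl mulfV ?gt_eqF.
rewrite [RHS]big_mkcond /=; apply: eq_bigr => k _; rewrite !mxE.
case: ifP => _; rewrite /= ?mulr0n ?mulr1n; last by rewrite !mul0r.
by rewrite !div1r -invfM -expr2 sqr_sqrtr // ltW.
Qed.

Lemma embedE (v : 'cV[R]_n) k : (embed *m v) k 0 = if enum_val k is inl i then v i 0 else 0 :> R.
Proof.
rewrite mxE; case E: (enum_val k) => [i|o].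
  rewrite -(sum_indicator i (fun j => v j 0)); apply: eq_bigr => j _.
  by rewrite mxE E (inj_eq (@inl_inj _ _)) eq_sym.
by rewrite big1 // => j _; rewrite mxE E mul0r.
Qed.

Lemma embed_norm : embed^T *m embed = 1%:M.
Proof.
apply/matrixP => i j; rewrite !mxE.
rewrite (eq_bigr (fun k => (enum_val k == inl i)%:R * (enum_val k == inl j)%:R));
  last by move=> k _; rewrite !mxE.
rewrite (sum_enum (fun q => (q == inl i)%:R * (q == inl j)%:R)) sum_indicator.
by rewrite (inj_eq (@inl_inj _ _)).
Qed.

Lemma ket_norm q : (ket q)^T *m ket q = 1%:M.
Proof.
apply/matrixP => i j; rewrite !ord1 !mxE eqxx.
rewrite (eq_bigr (fun k => (enum_val k == q)%:R * (enum_val k == q)%:R));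
  last by move=> k _; rewrite !mxE.
by rewrite (sum_enum (fun r => (r == q)%:R * (r == q)%:R)) sum_indicator eqxx.
Qed.

Lemma ket_coord q (A : 'cV[R]_#|{: Q}|) : (ket q)^T *m A = (A (enum_rank q) 0)%:M.
Proof.
apply/matrixP => i j; rewrite !ord1 !mxE eqxx mulr1n.
rewrite (eq_bigr (fun k => (enum_val k == q)%:R * A (enum_rank (enum_val k)) 0));
  last by move=> k _; rewrite !mxE enum_valK.
by rewrite (sum_enum (fun r => (r == q)%:R * A (enum_rank r) 0)) sum_indicator.
Qed.

Lemma embed_ket e (v : 'cV[R]_n) : (embed *m v)^T *m ket (inr e) = 0.
Proof.
rewrite -[LHS]trmxK trmx_mul trmxK ket_coord embedE enum_rankK.
by rewrite raddf0 trmx0.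
Qed.

(** With E the all-ones matrix, the row [None] contributes E/n to the Gram matrix and the rows of
    ordered pairs contribute 1 - E/n. *)
Lemma query_norm : query_mx^T *m query_mx = 1%:M.
Proof.
have n0 : 0 < n%:R :> R by rewrite ltr0n; lia.
apply/matrixP => i j; rewrite !mxE.
rewrite (eq_bigr (fun k => query_amp (enum_val k) i * query_amp (enum_val k) j));
  last by move=> k _; rewrite !mxE.
rewrite (sum_enum (fun q => query_amp q i * query_amp q j)) big_sumType /=.
rewrite big1 ?add0r; last by move=> a _; rewrite mul0r.
rewrite sum_option /= -invfM -expr2 sqr_sqrtr ?ltW //.
rewrite (eq_bigr (fun p : 'I_n * 'I_n => (2 * n%:R)^-1 * (
   (p.1 == i)%:R * (i == j)%:R + (p.2 == i)%:R * (i == j)%:R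
   - (p.1 == i)%:R * (p.2 == j)%:R - (p.2 == i)%:R * (p.1 == j)%:R))); last first.
  move=> [a b] _ /=; rewrite mulrACA -invfM -expr2 sqr_sqrtr ?mulr_ge0 ?ltW // mulrC.
  congr (_ * _); rewrite mulrBl !mulrBr.
  have e (c : 'I_n) : (c == i)%:R * (c == j)%:R = (c == i)%:R * (i == j)%:R :> R.
    by case: eqP => [->|]; rewrite ?mul0r.
  by rewrite !e; ring.
rewrite -mulr_sumr -(pair_bigA _ (fun a b : 'I_n =>
   (a == i)%:R * (i == j)%:R + (b == i)%:R * (i == j)%:R
   - (a == i)%:R * (b == j)%:R - (b == i)%:R * (a == j)%:R)) /=.
have sum1 (t : 'I_n) : \sum_(s < n) (s == t)%:R = 1 :> R.
  by rewrite -[RHS](sum_indicator t (fun=> 1)); apply: eq_bigr => s _; rewrite mulr1.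
rewrite (eq_bigr (fun a : 'I_n => (a == i)%:R * (i == j)%:R * n%:R + (i == j)%:R
   - (a == i)%:R - (a == j)%:R)); last first.
  move=> a _; rewrite !sumrB big_split /= -!mulr_suml -!mulr_sumr !sum1 mul1r mulr1 mul1r.
  by rewrite sumr_const card_ord -[_ *+ n]mulr_natr mulrAC.
rewrite !sumrB big_split /= -!mulr_suml !sum1 sumr_const card_ord -[(i == j)%:R *+ n]mulr_natr.
by case: (i == j); field; rewrite gt_eqF.
Qed.

Lemma query_embed : query_mx^T *m embed = 0.
Proof.
apply/matrixP => i j; rewrite !mxE big1 // => k _; rewrite !mxE.
by case: (enum_val k) => [a|o] /=; rewrite ?mul0r ?mulr0.
Qed.

Definition query_op := reflection embed query_mx.
(** Being an involution, the same operator prepares the uniform state and, after the reading, maps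
    it back to its basis state. *)
Definition prepare_op e := reflection (ket (inr e)) (embed *m uniform e).

Lemma query_op_unitary : query_op *m query_op^T = 1%:M.
Proof. exact: reflectionK embed_norm query_norm query_embed. Qed.

Lemma embed_uniform_norm e :
  (embed *m uniform e)^T *m (embed *m uniform e) = 1%:M.
Proof. by rewrite trmx_mul mulmxA -(mulmxA _ _ embed) embed_norm mulmx1 uniform_norm. Qed.

Lemma prepare_op_unitary e : prepare_op e *m (prepare_op e)^T = 1%:M.
Proof. exact: reflectionK (ket_norm _) (embed_uniform_norm e) (embed_ket _ _). Qed.

Lemma query_op_embed (v : 'cV[R]_n) : query_op *m (embed *m v) = query_mx *m v.
Proof. by rewrite mulmxA reflectionJ ?embed_norm ?query_embed. Qed.

Lemma prepare_op_ket e : prepare_op e *m ket (inr e) = embed *m uniform e.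
Proof. by rewrite reflectionJ ?ket_norm ?embed_ket. Qed.

Lemma prepare_op_uniform e : prepare_op e *m (embed *m uniform e) = ket (inr e).
Proof. by rewrite reflectionW ?embed_uniform_norm ?embed_ket. Qed.

(** The operator is symmetric, so it can be moved onto the basis state, which it turns into the
    uniform state. *)
Lemma prepare_op_coord e (v : 'cV[R]_n) :
  (prepare_op e *m (embed *m v)) (enum_rank (inr e)) 0 = ((uniform e)^T *m v) 0 0.
Proof.
have := ket_coord (inr e) (prepare_op e *m (embed *m v)).
move/(congr1 (fun A : 'M[R]_1 => A 0 0)); rewrite [in RHS]mxE eqxx mulr1n => <-.
rewrite mulmxA -[prepare_op e]tr_reflection -trmx_mul prepare_op_ket.
by rewrite trmx_mul mulmxA -(mulmxA _ _ embed) embed_norm mulmx1.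
Qed.

Definition flip_op (b : bool) (pos : nat) : 'M[R]_#|{: Q}| :=
  diag_mx (\row_(k < #|{: Q}|)
    (if (enum_val k : Q) is inl i then (-1) ^+ (b && (i == pos :> nat)) else 1)).

Lemma flip_op_unitary b pos : flip_op b pos *m (flip_op b pos)^T = 1%:M.
Proof.
rewrite tr_diag_mx mulmx_diag -diag_const_mx; congr diag_mx.
apply/rowP => k; rewrite !mxE; case: (enum_val k) => [i|_]; last by rewrite mulr1.
by rewrite -expr2 sqrr_sign.
Qed.

Lemma flip_op_embed b pos (v : 'cV[R]_n) : flip_op b pos *m (embed *m v) =
  embed *m \col_i ((-1) ^+ (b && (i == pos :> nat)) * v i 0).
Proof.
apply/colP => k; rewrite mul_diag_mx mxE !embedE mxE.
by case: (enum_val k) => [i|_]; rewrite ?mxE ?mulr0.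
Qed.

(** A halted state holds its verdict. A running one holds the phase, the number of bits read in the
    current block, which reaches n, and the pair found by the query. *)
Local Notation cstate := (bool + phase * 'I_n.+1 * option ('I_n * 'I_n))%type.

Definition step_op (s : cstate) (g : tape_sym letter) : 'M[R]_#|{: Q}| :=
  if s is inr (ph, pos, e) then
    match ph, g with
    | _, tape_letter (Some b) => flip_op b pos
    | ReadX1, lend_marker => prepare_op None
    | ReadY1, tape_letter None => query_op
    | Prepare, tape_letter None => prepare_op e
    | ReadY2, rend_marker => prepare_op e
    | _, _ => 1%:M
    end
  else 1%:M.

Definition measured (s : cstate) (g : tape_sym letter) : bool :=
  if s is inr (ph, pos, e) then
    match ph, g with
    | ReadY1, tape_letter None => true
    | ReadY2, rend_marker => true
    | _, _ => false
    end
  else false.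

Definition step_meas (s : cstate) (g : tape_sym letter) (c : Q) : 'M[R]_#|{: Q}| :=
  if measured s g then delta_mx (enum_rank c) (enum_rank c)
  else (c == inr None)%:R%:M.

(** The answer [inr None] has amplitude proportional to the sum of the signs, which vanishes on no
    instances, so it may accept at once. At the end, acceptance means that the uniform state was
    recovered. *)
Definition step_trans (s : cstate) (g : tape_sym letter) (c : Q) : cstate :=
  if s is inr (ph, pos, e) then
    match ph, g with
    | _, tape_letter (Some b) => inr (ph, inord pos.+1, e)
    | ReadX1, tape_letter None => inr (ReadY1, ord0, e)
    | ReadY1, tape_letter None =>
        match c with
        | inr None => inl true
        | inr (Some p) => inr (Prepare, ord0, Some p)
        | inl _ => inl false
        end
    | Prepare, tape_letter None => inr (ReadX2, ord0, e)
    | ReadX2, tape_letter None => inr (ReadY2, ord0, e)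
    | ReadY2, rend_marker => inl (c == inr e)
    | _, _ => s
    end
  else s.

Lemma step_op_unitary s g : step_op s g *m (step_op s g)^T = 1%:M.
Proof.
case: s => [b|[[ph pos] e]] /=; first by rewrite trmx1 mulmx1.
by case: ph; case: g => [|[b|]|] /=;
  rewrite ?trmx1 ?mulmx1 ?flip_op_unitary ?prepare_op_unitary ?query_op_unitary.
Qed.

Lemma adjoint_real (k l : nat) (A : 'M[R]_(k, l)) : (real_mx A) ^t* = real_mx A^T.
Proof. by apply/matrixP => i j; rewrite !mxE; apply: conjc_real. Qed.

Lemma real_unitary s g : real_mx (step_op s g) \is unitarymx.
Proof. by apply/unitarymxP; rewrite adjoint_real -map_mxM step_op_unitary map_mx1. Qed.

Lemma step_meas_projective s g :
  projective_measurement (fun c => real_mx (step_meas s g c)).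
Proof.
rewrite /step_meas; case: (measured s g); split.
- by move=> c; rewrite adjoint_real trmx_delta.
- by move=> c; rewrite -map_mxM mul_delta_mx.
- move=> c c' cc'; rewrite -map_mxM mul_delta_mx_0 ?map_mx0 //.
  by apply: contra_neq cc' => /enum_rank_inj.
- rewrite -map_mx_sum -(map_mx1 (real_complex R)); congr map_mx.
  rewrite mx1_sum_delta (reindex (@enum_rank Q)) //=.
  exact: onW_bij (@enum_rank_bij _).
- by move=> c; rewrite adjoint_real tr_scalar_mx.
- by move=> c; rewrite -map_mxM -scalar_mxM; case: eqP => _; rewrite ?mulr1 ?mulr0.
- move=> c c' cc'; rewrite -map_mxM -scalar_mxM -natrM mulnb.
  rewrite (_ : _ && _ = false) ?raddf0 //; apply/negP => /andP[/eqP e1 /eqP e2].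
  by rewrite e1 e2 eqxx in cc'.
- rewrite -map_mx_sum -(map_mx1 (real_complex R)); congr map_mx.
  rewrite (bigD1 (inr None)) //= big1 ?addr0 // => c /negbTE ->.
  by rewrite raddf0.
Qed.

Lemma acc_rej_disjoint : [disjoint [set inl true : cstate] & [set inl false : cstate]].
Proof. by rewrite disjoints1 inE. Qed.

Definition two_query_qcfa : qcfa R letter :=
  @QCFA R letter Q cstate Q (fun s g => real_mx (step_op s g))
    (fun s g c => real_mx (step_meas s g c)) step_trans (inr None)
    (inr (ReadX1, ord0, None)) [set inl true] [set inl false]
    acc_rej_disjoint (fun s g _ => real_unitary s g) step_meas_projective.

Local Notation M := two_query_qcfa.
Implicit Types (F : {set qcfa_cstate M}) (u : seq (tape_sym letter)).

(** * Certain runs on words x#y##x#y *)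

Lemma certain_unmeasured F u t g (phi : 'cV[R]_#|{: Q}|) :
  ~~ measured (inr t) g ->
  @certain R letter M F u (step_trans (inr t) g (inr None)) (real_mx (step_op (inr t) g *m phi)) ->
  @certain R letter M F (g :: u) (inr t) (real_mx phi).
Proof.
move=> /negbTE nm h /=; rewrite !inE /= => c.
rewrite /step_meas nm -!map_mxM mul_scalar_mx.
case: eqP => [->|_]; first by rewrite scale1r.
by rewrite scale0r map_mx0; apply: certain0.
Qed.

Lemma certain_measured F u t g (phi : 'cV[R]_#|{: Q}|) :
  measured (inr t) g ->
  (forall c, (step_op (inr t) g *m phi) (enum_rank c) 0 != 0 ->
     @certain R letter M F u (step_trans (inr t) g c) (real_mx (ket c))) ->
  @certain R letter M F (g :: u) (inr t) (real_mx phi).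
Proof.
move=> m h /=; rewrite !inE /= => c.
rewrite /step_meas m -!map_mxM; set psi := _ *m phi.
have -> : delta_mx (enum_rank c) (enum_rank c) *m psi = psi (enum_rank c) 0 *: ket c.
  apply/colP => k; rewrite !mxE (bigD1 (enum_rank c)) //= big1 ?addr0.
    rewrite !mxE eqxx andbT mulrC; congr (_ * _%:R).
    by rewrite -(inj_eq enum_val_inj) enum_rankK.
  by move=> j /negbTE jc; rewrite mxE jc andbF mul0r.
have [->|p0] := eqVneq (psi (enum_rank c) 0) 0.
  by rewrite scale0r map_mx0; apply: certain0.
by rewrite map_mxZ; apply/certainZ/h.
Qed.

Definition phased (x : n.-tuple bool) (v : 'cV[R]_n) : 'cV[R]_n :=
  \col_i ((-1) ^+ tnth x i * v i 0).

Lemma certain_bits F u ph e (x : n.-tuple bool) (v : 'cV[R]_n) :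
  (forall pos, @certain R letter M F u (inr (ph, pos, e)) (real_mx (embed *m phased x v))) ->
  @certain R letter M F ([seq tape_letter a | a <- bits x] ++ u)
    (inr (ph, ord0, e)) (real_mx (embed *m v)).
Proof.
move=> h.
(* The induction runs over the rest [l] of the block: only positions from [pos] on still receive
   their signs. *)
have gen (l : seq bool) (pos : 'I_n.+1) (w : 'cV[R]_n) : (pos + size l <= n)%N ->
    (forall pos', @certain R letter M F u (inr (ph, pos', e))
      (real_mx (embed *m \col_i ((-1) ^+ ((pos <= i)%N && nth false l (i - pos)) * w i 0)))) ->
    @certain R letter M F ([seq tape_letter (Some b : letter) | b <- l] ++ u)
      (inr (ph, pos, e)) (real_mx (embed *m w)).
  elim: l pos w => [|b l IH] pos w; rewrite [size _]/= => le_n hw.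
    rewrite cat0s; have := hw pos; congr (certain _ _ _ (real_mx (_ *m _))).
    by apply/colP => i; rewrite mxE nth_nil andbF mul1r.
  rewrite map_cons cat_cons; apply: certain_unmeasured; first by case: (ph).
  have -> : step_op (inr (ph, pos, e)) (tape_letter (Some b)) = flip_op b pos by case: (ph).
  have -> : step_trans (inr (ph, pos, e)) (tape_letter (Some b)) (inr None) =
    inr (ph, inord pos.+1, e) by case: (ph).
  have posE : nat_of_ord (inord pos.+1 : 'I_n.+1) = pos.+1 by rewrite inordK //; lia.
  rewrite flip_op_embed; apply: IH; first by rewrite posE; lia.
  move=> pos'; have := hw pos'; congr (certain _ _ _ (real_mx (_ *m _))).
  apply/colP => i; rewrite !mxE posE mulrA -signr_addb; congr ((-1) ^+ _ * _).
  case: (ltngtP i pos) => [lt|gt|->] /=; rewrite ?andbF ?andbT //.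
    by rewrite addbF (_ : (i - pos = (i - pos.+1).+1)%N) //; lia.
  by rewrite subnn.
rewrite /bits -map_comp; apply: gen => [|pos]; first by rewrite size_tuple.
have := h pos; congr (certain _ _ _ (real_mx (_ *m _))).
by apply/colP => i; rewrite !mxE /= subn0 -tnth_nth.
Qed.

Definition xor_sign (x y : n.-tuple bool) (v : 'cV[R]_n) : 'cV[R]_n :=
  \col_i ((-1) ^+ (tnth x i != tnth y i) * v i 0).

Lemma phased_phased (x y : n.-tuple bool) v : phased y (phased x v) = xor_sign x y v.
Proof.
apply/colP => i; rewrite !mxE mulrA -signr_addb.
by case: (tnth x i); case: (tnth y i).
Qed.

Lemma query_coord (v : 'cV[R]_n) c :
  (query_mx *m v) (enum_rank c) 0 = \sum_i query_amp c i * v i 0.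
Proof. by rewrite mxE; apply: eq_bigr => i _; rewrite mxE enum_rankK. Qed.

Lemma tape_xyxy (x y : n.-tuple bool) :
  let B z := [seq tape_letter a | a <- bits z] in
  let sh := tape_letter sharp in
  tape (xyxy x y) = lend_marker ::
    (B x ++ sh :: (B y ++ sh :: sh :: (B x ++ sh :: (B y ++ [:: rend_marker])))).
Proof. by rewrite /tape /xyxy /= !(map_cat, map_cons, rcons_cat, rcons_cons, cats1). Qed.

(** Both verdicts follow the same run; only the amplitude of [None] at the query and the amplitudes
    at the right end-marker depend on the instance. *)
Lemma two_query_certain F (x y : n.-tuple bool) :
  ((query_mx *m xor_sign x y (uniform None)) (enum_rank (inr None)) 0 != 0 ->
    (inl true : cstate) \in F) ->
  (forall a b, (tnth x a != tnth y a) != (tnth x b != tnth y b) ->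
    forall c, (prepare_op (Some (a, b)) *m
       (embed *m xor_sign x y (uniform (Some (a, b))))) (enum_rank c) 0 != 0 ->
    (inl (c == inr (Some (a, b))) : cstate) \in F) ->
  @certain R letter M F (tape (xyxy x y)) (qcfa_s0 M) (real_mx (ket (inr None))).
Proof.
move=> hnone hsome; rewrite tape_xyxy.
apply: certain_unmeasured => //; rewrite [step_op _ _]/= [step_trans _ _ _]/= prepare_op_ket.
apply: certain_bits => pos1.
apply: certain_unmeasured => //; rewrite [step_op _ _]/= [step_trans _ _ _]/= mul1mx.
apply: certain_bits => pos2; rewrite phased_phased.
apply: certain_measured => // c; rewrite [step_op _ _]/= query_op_embed.
case: c => [i|[[a b]|]] amp; rewrite [step_trans _ _ _]/=; last first.
- by apply: certain_halt; [rewrite !inE|apply: hnone].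
- have {amp} zab : (tnth x a != tnth y a) != (tnth x b != tnth y b).
    (* The amplitude of (a, b) is proportional to the difference of the signs at a and b. *)
    apply: contra_neq amp => zab; rewrite query_coord /=.
    rewrite (eq_bigr (fun i => (Num.sqrt (2 * n%:R))^-1 *
      ((i == a)%:R * xor_sign x y (uniform None) i 0
       - (i == b)%:R * xor_sign x y (uniform None) i 0))); last first.
      by move=> i _; rewrite (eq_sym a) (eq_sym b); ring.
    by rewrite -mulr_sumr sumrB !sum_indicator !mxE zab !inE subrr mulr0.
  apply: certain_unmeasured => //; rewrite [step_op _ _]/= [step_trans _ _ _]/= prepare_op_ket.
  apply: certain_bits => pos3.
  apply: certain_unmeasured => //; rewrite [step_op _ _]/= [step_trans _ _ _]/= mul1mx.
  apply: certain_bits => pos4; rewrite phased_phased.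
  apply: certain_measured => // c; rewrite [step_op _ _]/= [step_trans _ _ _]/= => amp /= _.
  exact: hsome.
- by move: amp; rewrite query_coord big1 ?eqxx // => j _; rewrite mul0r.
Qed.

Lemma two_query_run F (x y : n.-tuple bool) :
  @certain R letter M F (tape (xyxy x y)) (qcfa_s0 M) (real_mx (ket (inr None))) ->
  qcfa_run_prob F (xyxy x y) = 1.
Proof.
rewrite /qcfa_run_prob.
have -> : delta_mx (enum_rank (qcfa_q0 M)) 0 = real_mx (ket (inr None)).
  apply/colP => k; rewrite !mxE eqxx andbT rmorph_nat; congr _%:R.
  by rewrite -(inj_eq enum_val_inj) enum_rankK.
move/certain_prob; apply; apply/eqP; rewrite -(eqrXn2 (n := 2)) ?qnorm_ge0 //.
apply/eqP/complexI; rewrite qnorm_sqr adjoint_real -map_mxM ket_norm map_mx1.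
by rewrite mxE expr1n.
Qed.

(** The differing positions or the agreeing ones number at most one. Since a and b are of different
    kinds, the exceptional position, if any, is a or b. *)
Lemma hamming_nearly_constant (x y : n.-tuple bool) (a b : 'I_n) :
  hamming x y \in [:: 0; 1; n - 1; n]%N ->
  (tnth x a != tnth y a) != (tnth x b != tnth y b) ->
  exists s, forall k, k \in ~: [set a; b] -> (tnth x k != tnth y k) = s.
Proof.
rewrite /hamming; set D := [set i | _] => hD zab.
have zE k : (tnth x k != tnth y k) = (k \in D) by rewrite inE.
move: zab; rewrite !zE => zab.
wlog [aD bD] : a b zab / a \in D /\ b \notin D.
  move=> wl; case: (boolP (a \in D)) (zab) => aD; case: (boolP (b \in D)) => bD // _.
    by apply: wl => //; split.
  have [||s hs] := wl b a => //; first by rewrite eq_sym.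
  by exists s => k kab; apply: hs; rewrite setUC.
have [D1|Dn] : (#|D| <= 1)%N \/ (#|~: D| <= 1)%N.
  have := cardsC D; rewrite card_ord; move: hD; rewrite !inE.
  by move=> /or4P[]/eqP -> h; [left|left|right|right]; move: h; lia.
  exists false => k; rewrite !inE negb_or => /andP[ka _]; rewrite zE.
  apply: contraNF ka => kD; apply/eqP.
  by move/card_le1_eqP: D1; apply.
exists true => k; rewrite !inE negb_or => /andP[_ kb]; rewrite zE.
apply: contraNT kb => kD; apply/eqP.
by move/card_le1_eqP: Dn; apply; rewrite inE.
Qed.

(** Away from a and b the signs agree, so the reading changes the uniform state only by a global
    sign and the last operator returns it exactly. *)
Lemma two_query_accepts (x y : n.-tuple bool) : hamming x y \in [:: 0; 1; n - 1; n]%N ->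
  qcfa_accept_prob M (xyxy x y) = 1.
Proof.
move=> hxy; apply/two_query_run/two_query_certain; first by rewrite inE.
move=> a b zab c; have [s hs] := hamming_nearly_constant hxy zab.
have -> : xor_sign x y (uniform (Some (a, b))) = (-1) ^+ s *: uniform (Some (a, b)).
  apply/colP => k; rewrite !mxE; case: (boolP (k \in index_set (Some (a, b)))) => [/hs ->//|_].
  by rewrite !mul0r !mulr0.
rewrite -!scalemxAr prepare_op_uniform !mxE enum_rankK inE.
by case: (c == inr _) => //; rewrite mulr0 eqxx.
Qed.

Lemma sum_signs (z : 'I_n -> bool) :
  \sum_i (-1) ^+ z i = n%:R - 2 * #|[set i | z i]|%:R :> R.
Proof.
rewrite (eq_bigr (fun i => 1 - 2 * (z i)%:R)); last first.
  by move=> i _; case: (z i) => /=; rewrite ?expr0 ?expr1; lra.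
rewrite sumrB sumr_const card_ord -mulr_sumr; congr (_ - _ * _).
rewrite -natr_sum; congr _%:R; rewrite -sum1_card [RHS]big_mkcond /=.
by apply: eq_bigr => i _; rewrite inE; case: (z i).
Qed.

(** The signs sum to 0, which excludes the answer [None]. Positions a and b have opposite signs, so
    the others also sum to 0 and the final state is orthogonal to the accepting outcome. *)
Lemma two_query_rejects (x y : n.-tuple bool) : ~~ odd n -> hamming x y = n./2 ->
  qcfa_reject_prob M (xyxy x y) = 1.
Proof.
move=> even_n hxy.
have bal : \sum_i (-1) ^+ (tnth x i != tnth y i) = 0 :> R.
  rewrite (sum_signs (fun i => tnth x i != tnth y i)) -/(hamming x y) hxy.
  by rewrite -natrM -[X in X%:R - _]even_halfK // mul2n subrr.
apply/two_query_run/two_query_certain.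
  rewrite query_coord /= (eq_bigr (fun i => (Num.sqrt n%:R)^-1 * (Num.sqrt #|index_set None|%:R)^-1
    * (-1) ^+ (tnth x i != tnth y i))); last first.
    by move=> i _; rewrite !mxE /= in_setT div1r mulrA mulrAC.
  by rewrite -mulr_sumr bal mulr0 eqxx.
move=> a b zab c; have [->|_] := eqVneq c (inr (Some (a, b))); last by rewrite inE.
rewrite prepare_op_coord mxE.
rewrite (eq_bigr (fun i => (Num.sqrt #|index_set (Some (a, b))|%:R)^-1 ^+ 2 *
  ((i \in ~: [set a; b])%:R * (-1) ^+ (tnth x i != tnth y i)))); last first.
  by move=> i _; rewrite !mxE /=; move: ((-1) ^+ _) => s; case: (i \in _) => /=; ring.
rewrite -mulr_sumr.
have -> : \sum_i (i \in ~: [set a; b])%:R * (-1) ^+ (tnth x i != tnth y i) = 0 :> R.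
  have ba : b != a by apply: contraNneq zab => ->.
  move: bal; rewrite (bigD1 a) //= (bigD1 b) //= addrA => bal.
  rewrite (bigD1 a) //= (bigD1 b) //= !inE !eqxx /= orbT !mul0r !add0r.
  have z0 : (-1) ^+ (tnth x a != tnth y a) + (-1) ^+ (tnth x b != tnth y b) = 0 :> R.
    move: zab; case: (tnth x a != _); case: (tnth x b != _) => //= _;
    by rewrite ?expr0 ?expr1; lra.
  rewrite -[RHS]bal z0 add0r; apply: eq_bigr => i /andP[ia ib].
  by rewrite !inE (negbTE ia) (negbTE ib) mul1r.
by rewrite mulr0 eqxx.
Qed.

Lemma two_query_solves : ~~ odd n -> qcfa_solves_exactly M (problem_A n).
Proof.
move=> even_n; split=> w [x [y [-> hxy]]].
  exact: two_query_accepts.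
exact: two_query_rejects.
Qed.

Lemma two_query_qstates : (#|qcfa_qstate M| <= 3 * n ^ 2)%N.
Proof. by rewrite /= card_sum card_option card_prod card_ord; nia. Qed.

Lemma two_query_cstates : (#|qcfa_cstate M| <= 40 * n ^ 3)%N.
Proof.
rewrite /= card_sum card_bool !card_prod card_option card_prod !card_ord.
have : (#|{: phase}| * n.+1 * (n * n).+1 <= 5 * n.+1 * (n * n).+1)%N.
  by rewrite !leq_mul2r card_phase !orbT.
by move=> h; apply: leq_trans (leq_add (leqnn 2) h) _; nia.
Qed.

End Machine.

Theorem theorem3 (R : realType) :
  (exists a b : nat, forall n : nat, ~~ odd n -> (4 <= n)%N ->
     exists M : qcfa R letter,
       [/\ qcfa_solves_exactly M (problem_A n),
           (#|qcfa_qstate M| <= a * n ^ 2)%N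
         & (#|qcfa_cstate M| <= b * n ^ 3)%N]) /\
  (exists c : R, 0 < c /\
     forall n : nat, ~~ odd n -> forall D : dfa letter,
       dfa_solves D (problem_A n) -> 2 `^ (c * n%:R) <= #|dfa_state D|%:R).
Proof.
split; last exact: dfa_lower_bound.
exists 3%N, 40%N => n even_n n_ge4; exists (two_query_qcfa R n_ge4).
by split; [exact: two_query_solves|exact: two_query_qstates|exact: two_query_cstates].
Qed.
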